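(* Let $\mathbf H=(\mathbf G,F)$ be an $F$-sup-semilattice. Let $\mathbb S$ denote the category of sup-semilattices and $\mathbb J$ the category of frames and frame homomorphisms. Then: (a) For an arbitrary frame $\mathbf J=(T,S)$ there exists a unique homomorphism of frames $\varphi_{\mathbf J}\colon\mathbf J\to\mathbf J[\mathbf H,\mathbf J\otimes\mathbf H]$ defined for arbitrary $x\in G$ and $i\in T$ by $(\varphi_{\mathbf J}(i))(x)=\mathrm n(j[\mathbf J,\mathbf H])(x_{i=})$. Moreover, $\varphi=(\varphi_{\mathbf J})_{\mathbf J\in\mathbb J}$ is a natural transformation from the identity functor on $\mathbb J$ to the endofunctor $\mathbf J[\mathbf H,-\otimes\mathbf H]$. (b) For an arbitrary sup-semilattice $\mathbf L$ there exists a unique sup-semilattice morphism $\psi_{\mathbf L}\colon\mathbf J[\mathbf H,\mathbf L]\otimes\mathbf H\to\mathbf L$ such that $\psi_{\mathbf L}\circ\mathrm n(j[\mathbf J[\mathbf H,\mathbf L],\mathbf H])=f_{\mathbf L}$, where $f_{\mathbf L}\colon\mathbf G^{T_{[\mathbf H,\mathbf L]}}\to\mathbf L$ is defined by $f_{\mathbf L}(x)=\bigvee_{\alpha\in T_{[\mathbf H,\mathbf L]}}\alpha(x(\alpha))$ for $x\in G^{T_{[\mathbf H,\mathbf L]}}$. Moreover, $\psi=(\psi_{\mathbf L})_{\mathbf L\in\mathbb S}$ is a natural transformation from the endofunctor $\mathbf J[\mathbf H,-]\otimes\mathbf H$ to the identity functor on $\mathbb S$. (c) There is an adjoint situation $(\varphi,\psi)\colon(-\otimes\mathbf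 H)\dashv\mathbf J[\mathbf H,-]\colon\mathbb S\to\mathbb J$; that is, $-\otimes\mathbf H\colon\mathbb J\to\mathbb S$ is left adjoint to $\mathbf J[\mathbf H,-]\colon\mathbb S\to\mathbb J$ with unit $\varphi$ and counit $\psi$.
   Context: A sup-semilattice is a poset in which every subset has a join (bottom element $0$); morphisms of sup-semilattices are maps preserving arbitrary joins. An $F$-sup-semilattice is a pair $(\mathbf G,F)$ where $\mathbf G$ is a sup-semilattice and $F\colon G\to G$ preserves arbitrary joins. A frame $\mathbf J=(T,S)$ is a set $T$ with a binary relation $S\subseteq T^2$; a homomorphism of frames $(T_1,S_1)\to(T_2,S_2)$ is a map $t\colon T_1\to T_2$ such that $(i,j)\in S_1$ implies $(t(i),t(j))\in S_2$. Functor $\mathbf J[\mathbf H,-]\colon\mathbb S\to\mathbb J$: for a sup-semilattice $\mathbf L$, the frame $\mathbf J[\mathbf H,\mathbf L]=(T_{[\mathbf H,\mathbf L]},S_{[\mathbf H,\mathbf L]})$ has $T_{[\mathbf H,\mathbf L]}$ equal to the set of all sup-semilattice morphisms $\mathbf G\to\mathbf L$, and $(\alpha,\beta)\in S_{[\mathbf H,\mathbf L]}$ iff $\beta(x)\leq\alpha(F(x))$ for all $x\in G$; on morphisms, $\mathbf J[\mathbf H,g](\alpha)=g\circ\alpha$. Functor $-\otimes\mathbf H\colon\mathbb J\to\mathbb S$: Let $\mathbf J=(T,S)$ be a frame and $\mathbf G^T$ the set of maps $T\to G$ with pointwise order. For $x\in G$, $i\in T$ let $x_{iS}\in G^T$ be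 given by $x_{iS}(k)=x$ if $(i,k)\in S$ and $x_{iS}(k)=0$ otherwise; let $x_{i=}\in G^T$ be given by $x_{i=}(i)=x$ and $x_{i=}(k)=0$ for $k\neq i$. Put $[\mathbf J,\mathbf H]=\{(x_{iS}\vee F(x)_{i=},\,F(x)_{i=})\mid x\in G,\ i\in T\}\subseteq(G^T)^2$. Define $j=j[\mathbf J,\mathbf H]\colon G^T\to G^T$ by $$j(a)=a\vee\bigvee\{c\in G^T\mid\text{there is }d\leq a\text{ with }(c,d)\in[\mathbf J,\mathbf H]\text{ or }(d,c)\in[\mathbf J,\mathbf H]\}.$$ Then $\mathbf J\otimes\mathbf H$ is the set $\{a\in G^T\mid j(a)=a\}$ with the order inherited from $\mathbf G^T$, and $\mathrm n(j)\colon G^T\to\mathbf J\otimes\mathbf H$ is the closure operator $\mathrm n(j)(a)=\bigwedge\{x\in G^T\mid j(x)=x,\ a\leq x\}$. $\mathbf J\otimes\mathbf H$ is a sup-semilattice whose join of a subset $M$ is $\mathrm n(j)(\bigvee M)$ with $\bigvee M$ computed in $\mathbf G^T$. For a homomorphism of frames $t\colon\mathbf J_1=(T_1,S_1)\to\mathbf J_2=(T_2,S_2)$, $t\otimes\mathbf H$ is the unique sup-semilattice morphism $\mathbf J_1\otimes\mathbf H\to\mathbf J_2\otimes\mathbf H$ with $(t\otimes\mathbf H)\circ\mathrm n(j[\mathbf J_1,\mathbf H])=\mathrm n(j[\mathbf J_2,\mathbf H])\circ t^{\rightarrow}$, where $t^{\rightarrow}\colon\mathbf G^{T_1}\to\mathbf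 G^{T_2}$, $(t^{\rightarrow}(x))(k)=\bigvee\{x(i)\mid t(i)=k\}$. *)

(* Defs.v *)
From HB Require Import structures.
From mathcomp Require Import all_boot all_order.
From mathcomp Require Import boolp classical_sets.

Set Implicit Arguments.
Unset Strict Implicit.
Unset Printing Implicit Defensive.

Import Order.TTheory.
Local Open Scope classical_set_scope.
Local Open Scope order_scope.

Record category := Category {
  obj :> Type;
  hom : obj -> obj -> Type;
  idc : forall a, hom a a;
  comp : forall a b c, hom b c -> hom a b -> hom a c;
  comp_idl : forall a b (f : hom a b), comp (idc b) f = f;
  comp_idr : forall a b (f : hom a b), comp f (idc a) = f;
  comp_assoc : forall a b c d (f : hom a b) (g : hom b c) (h : hom c d),
    comp h (comp g f) = comp (comp h g) f }.
Arguments hom {_} a b.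
Arguments idc {_} a.
Arguments comp {_ _ _ _} _ _.

Record functor (C D : category) := Functor {
  fobj :> C -> D;
  fmap : forall a b : C, hom a b -> hom (fobj a) (fobj b);
  fmap_id : forall a, fmap (idc a) = idc (fobj a);
  fmap_comp : forall (a b c : C) (f : hom a b) (g : hom b c),
    fmap (comp g f) = comp (fmap g) (fmap f) }.
Arguments fmap {_ _} _ {_ _} _.

Definition functor_id (C : category) : functor C C :=
  @Functor C C id (fun _ _ => id) (fun=> erefl) (fun _ _ _ _ _ => erefl).

Section FunctorComp.
Variables (C D E : category) (Q : functor D E) (P : functor C D).

Lemma functor_comp_id a : fmap Q (fmap P (idc a)) = idc (Q (P a)).
Proof. by rewrite !fmap_id. Qed.

Lemma functor_comp_comp (a b c : C) (f : hom a b) (g : hom b c) :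
  fmap Q (fmap P (comp g f)) = comp (fmap Q (fmap P g)) (fmap Q (fmap P f)).
Proof. by rewrite !fmap_comp. Qed.

Definition functor_comp : functor C E :=
  @Functor C E (fun a => Q (P a)) (fun _ _ f => fmap Q (fmap P f))
    functor_comp_id functor_comp_comp.
End FunctorComp.

Definition natural (C D : category) (P Q : functor C D)
    (t : forall a : C, hom (P a) (Q a)) : Prop :=
  forall (a b : C) (f : hom a b), comp (fmap Q f) (t a) = comp (t b) (fmap P f).

(** [L] is left adjoint to [R : C -> D], with unit [eta] and counit [eps]. *)
Definition adjoint_situation (C D : category)
    (L : functor D C) (R : functor C D)
    (eta : forall d : D, hom d (R (L d)))
    (eps : forall c : C, hom (L (R c)) c) : Prop :=
  [/\ natural (P := functor_id D) (Q := functor_comp R L) eta,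
      natural (P := functor_comp L R) (Q := functor_id C) eps,
      forall d : D, comp (eps (L d)) (fmap L (eta d)) = idc (L d)
    & forall c : C, comp (fmap R (eps c)) (eta (R c)) = idc (R c)].

(** Joins are only required to exist; [join] below selects them, and
    [join_unique] shows that they are determined by the order. *)
Record sup_semilattice := SupSemilattice {
  ss_disp : Order.disp_t;
  ss_sort :> porderType ss_disp;
  ss_complete : forall A : set ss_sort, exists m, isLub A m }.

Section Joins.
Variable L : sup_semilattice.
Implicit Types (A B : set L) (a b c x : L).

Definition join A : L := sval (cid (ss_complete A)).
Definition bot : L := join set0.
Definition join2 a b : L := join [set a; b].
Definition meet A : L := join (lbound A).

Lemma joinP A : isLub A (join A).
Proof. exact: (svalP (cid (ss_complete A))). Qed.

Lemma join_ub A x : A x -> x <= join A.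
Proof. by move=> Ax; apply: (joinP A).1. Qed.

Lemma join_least A b : (forall x, A x -> x <= b) -> join A <= b.
Proof. by move=> Ab; apply: (joinP A).2. Qed.

Lemma join_unique A m : isLub A m -> join A = m.
Proof.
move=> [mA Am]; apply/eqP; rewrite eq_le (join_least mA) /=.
by apply: Am => x; apply: join_ub.
Qed.

Lemma bot_le x : bot <= x.
Proof. exact: join_least. Qed.

Lemma join2l a b : a <= join2 a b.
Proof. by apply: join_ub; left. Qed.

Lemma join2r a b : b <= join2 a b.
Proof. by apply: join_ub; right. Qed.

Lemma join2_least a b c : a <= c -> b <= c -> join2 a b <= c.
Proof. by move=> ac bc; apply: join_least => x [] ->. Qed.

Lemma meet_lb A x : A x -> meet A <= x.
Proof. by move=> Ax; apply: join_least => y; apply. Qed.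

Lemma meet_greatest A b : (forall x, A x -> b <= x) -> b <= meet A.
Proof. by move=> Ab; apply: join_ub. Qed.

End Joins.

Record sup_hom (G L : sup_semilattice) := SupHom {
  sup_fun :> G -> L;
  sup_hom_join : forall A : set G, sup_fun (join A) = join (sup_fun @` A) }.

Lemma sup_hom_eq (G L : sup_semilattice) (f g : sup_hom G L) :
  (forall x, f x = g x) -> f = g.
Proof.
case: f g => f fP [g gP] /= /funext fg; rewrite {}fg in fP *.
by congr SupHom; apply: Prop_irrelevance.
Qed.

Lemma sup_hom_le (G L : sup_semilattice) (f : sup_hom G L) (x y : G) :
  x <= y -> f x <= f y.
Proof.
move=> xy; have -> : y = join [set x; y].
  apply/esym/join_unique; split=> [z [] ->//|b]; apply; by right.
by rewrite sup_hom_join; apply: join_ub; exists x => //; left.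
Qed.

Lemma sup_hom_id_join (G : sup_semilattice) (A : set G) :
  id (join A) = join (id @` A).
Proof. by rewrite image_id. Qed.

Definition sup_hom_id (G : sup_semilattice) : sup_hom G G :=
  SupHom (@sup_hom_id_join G).

Lemma sup_hom_comp_join (G K L : sup_semilattice) (g : sup_hom K L)
    (f : sup_hom G K) (A : set G) :
  (g \o f) (join A) = join ((g \o f) @` A).
Proof. by rewrite /= !sup_hom_join image_comp. Qed.

Definition sup_hom_comp (G K L : sup_semilattice) (g : sup_hom K L)
  (f : sup_hom G K) : sup_hom G L := SupHom (sup_hom_comp_join g f).

Definition catS : category.
Proof.
apply: (@Category sup_semilattice sup_hom sup_hom_id sup_hom_comp) => *;
  exact: sup_hom_eq.
Defined.

Record F_sup_semilattice := FSupSemilattice {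
  fs_base :> sup_semilattice;
  fs_op : sup_hom fs_base fs_base }.

(** The pointwise order on [T -> G] is the instance [FunOrder] from [boolp]. *)
Section Power.
Variables (G : sup_semilattice) (T : Type).

Lemma power_isLub (A : set (T -> G)) :
  isLub A (fun k => join [set a k | a in A]).
Proof.
split=> [a Aa|b bA].
  by apply/lefP => k; apply: join_ub; exists a.
by apply/lefP => k; apply: join_least => _ [a Aa <-]; apply: (lefP _ _ (bA a Aa)).
Qed.

Lemma power_complete (A : set (T -> G)) : exists m, isLub A m.
Proof. by eexists; apply: power_isLub. Qed.

Definition power : sup_semilattice := SupSemilattice power_complete.

Lemma power_joinE (A : set power) k : join A k = join [set a k | a in A].
Proof. by rewrite (@join_unique power _ _ (power_isLub A)). Qed.

End Power.

Section Quotient.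
Variables (L : sup_semilattice) (X : set (L * L)).
Implicit Types a b x : L.

(** For [X = [J,H]] in [L = G^T], [jop] is the prenucleus [j[J,H]]. *)
Definition jop a : L :=
  join2 a (join [set c | exists2 d, d <= a & X (c, d) \/ X (d, c)]).

Definition jclosure a : L := meet [set x | jop x = x /\ a <= x].

Lemma jop_ge a : a <= jop a.
Proof. exact: join2l. Qed.

Lemma jop_le a b : a <= b -> jop a <= jop b.
Proof.
move=> ab; apply: join2_least; first exact: le_trans ab (jop_ge b).
apply: join_least => c [d da cd]; apply: le_trans (join2r _ _).
by apply: join_ub; exists d => //; apply: le_trans ab.
Qed.

Lemma jop_fixP b :
  jop b = b <-> forall c d, X (c, d) \/ X (d, c) -> d <= b -> c <= b.
Proof.
split=> [fb c d cd db|H].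
  by rewrite -fb; apply: le_trans (join2r _ _); apply: join_ub; exists d.
apply/eqP; rewrite eq_le jop_ge andbT; apply: join2_least => //.
by apply: join_least => c [d db cd]; apply: H cd db.
Qed.

Lemma jclosure_fix a : jop (jclosure a) = jclosure a.
Proof.
apply/eqP; rewrite eq_le jop_ge andbT; apply: meet_greatest => x [fx ax].
by rewrite -fx; apply/jop_le/meet_lb.
Qed.

Definition quot_type : Type := {a : L | a \in [set a | jop a = a]}.
HB.instance Definition _ := SubChoice.on quot_type.
HB.instance Definition _ :=
  [SubChoice_isSubPOrder of quot_type by <: with ss_disp L].

Lemma jclosure_mem a : jclosure a \in [set a | jop a = a].
Proof. by apply/mem_set/jclosure_fix. Qed.

(** [n(j)], corestricted to the fixed points of [j = jop]. *)
Definition quot_map a : quot_type := exist _ (jclosure a) (jclosure_mem a).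

Lemma quot_fix (b : quot_type) : jop (val b) = val b.
Proof. exact: set_mem (valP b). Qed.

Lemma quot_map_le a (b : quot_type) : (quot_map a <= b) = (a <= val b).
Proof.
apply/idP/idP => [ab|ab]; last by apply: meet_lb; split=> //; apply: quot_fix.
apply: le_trans (_ : jclosure a <= val b) => //.
by apply: meet_greatest => x [].
Qed.

Lemma quot_isLub (M : set quot_type) :
  isLub M (quot_map (join [set val a | a in M])).
Proof.
split=> [a Ma|b bM].
  apply: (@le_trans _ _ (join [set val a | a in M])).
    by apply: join_ub; exists a.
  by apply: meet_greatest => x [].
by rewrite quot_map_le; apply: join_least => _ [a Ma <-]; apply: bM.
Qed.

Lemma quot_complete (M : set quot_type) : exists m, isLub M m.
Proof. by eexists; apply: quot_isLub. Qed.

Definition quot : sup_semilattice := SupSemilattice quot_complete.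

Lemma quot_joinE (M : set quot) : join M = quot_map (join [set val a | a in M]).
Proof. exact: (@join_unique quot _ _ (quot_isLub M)). Qed.

Lemma quot_mapK (b : quot) : quot_map (val b) = b.
Proof.
apply/eqP; rewrite eq_le quot_map_le lexx /=.
by apply: meet_greatest => x [].
Qed.

End Quotient.

Record frame := Frame {
  fr_sort :> Type;
  fr_rel : fr_sort -> fr_sort -> Prop }.

Record frame_hom (J1 J2 : frame) := FrameHom {
  frame_fun :> J1 -> J2;
  frame_hom_rel : forall i k, fr_rel i k -> fr_rel (frame_fun i) (frame_fun k) }.

Lemma frame_hom_eq (J1 J2 : frame) (s t : frame_hom J1 J2) :
  (forall i, s i = t i) -> s = t.
Proof.
case: s t => s sP [t tP] /= /funext st; rewrite {}st in sP *.
by congr FrameHom; apply: Prop_irrelevance.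
Qed.

Definition frame_hom_id (J : frame) : frame_hom J J :=
  @FrameHom J J id (fun _ _ => id).

Definition frame_hom_comp (J1 J2 J3 : frame) (t : frame_hom J2 J3)
    (s : frame_hom J1 J2) : frame_hom J1 J3 :=
  @FrameHom J1 J3 (t \o s)
    (fun i k ik => frame_hom_rel t (frame_hom_rel s ik)).

Definition catJ : category.
Proof.
apply: (@Category frame frame_hom frame_hom_id frame_hom_comp) => *;
  exact: frame_hom_eq.
Defined.

Section HomFrame.
Variable H : F_sup_semilattice.

Definition hom_frame (L : sup_semilattice) : frame :=
  @Frame (sup_hom H L) (fun alpha beta => forall x : H, beta x <= alpha (fs_op H x)).

Section Map.
Variables (L1 L2 : sup_semilattice) (g : sup_hom L1 L2).

Lemma hom_frame_map_rel (alpha beta : hom_frame L1) :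
  fr_rel alpha beta ->
  @fr_rel (hom_frame L2) (sup_hom_comp g alpha) (sup_hom_comp g beta).
Proof. by move=> ab x; apply: sup_hom_le (ab x). Qed.

Definition hom_frame_map : frame_hom (hom_frame L1) (hom_frame L2) :=
  @FrameHom (hom_frame L1) (hom_frame L2) (sup_hom_comp g) hom_frame_map_rel.
End Map.

Definition hom_functor : functor catS catJ.
Proof.
apply: (@Functor catS catJ hom_frame hom_frame_map) => *;
  by apply: frame_hom_eq => alpha; apply: sup_hom_eq.
Defined.

End HomFrame.

Section Tensor.
Variable H : F_sup_semilattice.
Let F : sup_hom H H := fs_op H.

(** [x_S i x] and [x_eq i x] are the elements [x_{iS}] and [x_{i=}] of [G^T]. *)
Definition x_S (J : frame) (i : J) (x : H) : power H J :=
  fun k => if `[< fr_rel i k >] then x else bot H.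

Definition x_eq (J : frame) (i : J) (x : H) : power H J :=
  fun k => if `[< k = i >] then x else bot H.

Definition tensor_rel (J : frame) : set (power H J * power H J) :=
  [set p | exists (x : H) (i : J),
    p = (join2 (x_S i x) (x_eq i (F x)), x_eq i (F x))].
Arguments tensor_rel J : clear implicits.

Definition tensor (J : frame) : sup_semilattice := quot (tensor_rel J).

Definition tensor_n (J : frame) : power H J -> tensor J :=
  quot_map (tensor_rel J).

(** [push t] is the forward map of [t], from [G^T1] to [G^T2]. *)
Definition push (T1 T2 : Type) (t : T1 -> T2) (x : power H T1) : power H T2 :=
  fun k => join [set x i | i in [set i | t i = k]].

Lemma x_eq_le (J : frame) (i : J) x (b : power H J) :
  (x_eq i x <= b) = (x <= b i).
Proof.
apply/idP/idP => [/lefP/(_ i)|xb]; rewrite /x_eq ?asboolT //.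
by apply/lefP => k; rewrite /x_eq; case: asboolP => [->|_]//; apply: bot_le.
Qed.

Lemma x_S_leP (J : frame) (i : J) x (b : power H J) :
  x_S i x <= b <-> forall k, fr_rel i k -> x <= b k.
Proof.
split=> [/lefP xb k ik|xb]; first by have := xb k; rewrite /x_S asboolT.
apply/lefP => k; rewrite /x_S.
by case: asboolP => [/xb//|_]; apply: bot_le.
Qed.

Lemma tensor_fixP (J : frame) (b : power H J) :
  jop (tensor_rel J) b = b <->
  forall x i k, fr_rel i k -> F x <= b i -> x <= b k.
Proof.
split=> [/jop_fixP bJ x i k ik xi|bJ].
  have : join2 (x_S i x) (x_eq i (F x)) <= b.
    by apply: (bJ _ (x_eq i (F x))); [left; exists x, i|rewrite x_eq_le].
  by move/(le_trans (join2l _ _))/x_S_leP; apply.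
apply/jop_fixP => c d [[x [i [-> ->]]]|[x [i [-> ->]]]] db.
  apply: join2_least => //; apply/x_S_leP => k ik.
  by apply: bJ ik _; rewrite -x_eq_le.
exact: le_trans (join2r _ _) db.
Qed.

Lemma push_leP (T1 T2 : Type) (t : T1 -> T2) (a : power H T1) (b : power H T2) :
  push t a <= b <-> a <= ((b \o t) : power H T1).
Proof.
split=> [/lefP ab|/lefP ab]; apply/lefP.
  by move=> i; apply: le_trans (ab (t i)); apply: join_ub; exists i.
by move=> k; apply: join_least => _ [i <- <-]; apply: ab.
Qed.

Section Map.
Variables (J1 J2 : frame) (t : frame_hom J1 J2).

Lemma pull_fix (b : tensor J2) :
  jop (tensor_rel J1) (val b \o t) = val b \o t.
Proof.
have /tensor_fixP bJ := quot_fix b.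
by apply/tensor_fixP => x i k ik; apply: bJ; apply: frame_hom_rel.
Qed.

Definition pull (b : tensor J2) : tensor J1 :=
  exist _ (val b \o t) (mem_set (pull_fix b)).

Lemma tensor_n_le (J : frame) (a : power H J) (b : tensor J) :
  (tensor_n a <= b) = (a <= val b).
Proof. exact (@quot_map_le (power H J) (tensor_rel J) a b). Qed.

Lemma tensor_n_push_le (a : power H J1) (b : tensor J2) :
  (tensor_n (push t a) <= b) <->
  (tensor_n a <= pull b).
Proof. by rewrite !tensor_n_le push_leP. Qed.

Lemma tensor_n_push (a : power H J1) :
  tensor_n (push t (val (tensor_n a))) = tensor_n (push t a).
Proof.
have E (b : tensor J2) : tensor_n (push t (val (tensor_n a))) <= b <->
                         tensor_n (push t a) <= b.
  by rewrite !tensor_n_push_le [tensor_n (val _)]quot_mapK.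
by apply/eqP; rewrite eq_le; apply/andP; split; apply/E.
Qed.

Lemma tensor_map_join (A : set (tensor J1)) :
  tensor_n (push t (val (join A))) =
  join ((fun a => tensor_n (push t (val a))) @` A).
Proof.
have adj (c : tensor J1) (b : tensor J2) :
    tensor_n (push t (val c)) <= b <-> c <= pull b.
  by rewrite tensor_n_push_le [tensor_n _]quot_mapK.
apply/esym/join_unique; split=> [_ [a Aa <-]|b bA].
  by apply/adj; apply: le_trans (join_ub Aa) _; apply/adj.
by apply/adj; apply: join_least => a Aa; apply/adj/bA; exists a.
Qed.

Lemma tensor_map_exists_unique :
  exists! h : sup_hom (tensor J1) (tensor J2),
    h \o @tensor_n J1 = @tensor_n J2 \o push t.
Proof.
exists (SupHom tensor_map_join); split=> [|h hE].
  by apply/funext => a /=; apply: tensor_n_push.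
apply: sup_hom_eq => b /=; rewrite -[in RHS](quot_mapK b).
by have /(congr1 (@^~ (val b))) := hE.
Qed.

Definition tensor_map : sup_hom (tensor J1) (tensor J2) :=
  sval (cid tensor_map_exists_unique).

Lemma tensor_mapP : tensor_map \o @tensor_n J1 = @tensor_n J2 \o push t.
Proof. exact: (svalP (cid tensor_map_exists_unique)).1. Qed.

Lemma tensor_map_unique (h : sup_hom (tensor J1) (tensor J2)) :
  h \o @tensor_n J1 = @tensor_n J2 \o push t -> tensor_map = h.
Proof. exact: (svalP (cid tensor_map_exists_unique)).2. Qed.
End Map.

Lemma tensor_map_id (J : frame) : tensor_map (frame_hom_id J) = sup_hom_id (tensor J).
Proof.
apply: tensor_map_unique; apply/funext => a /=; congr tensor_n.
apply/funext => k; apply/esym/join_unique; split=> [_ [i -> <-]//|b].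
by apply; exists k.
Qed.

Lemma tensor_map_comp (J1 J2 J3 : frame) (s : frame_hom J1 J2) (t : frame_hom J2 J3) :
  tensor_map (frame_hom_comp t s) = sup_hom_comp (tensor_map t) (tensor_map s).
Proof.
apply: tensor_map_unique; apply/funext => a /=.
have /(congr1 (@^~ a)) /= -> := tensor_mapP s.
have /(congr1 (@^~ (push s a))) /= -> := tensor_mapP t.
congr tensor_n; apply/eqP; rewrite eq_le; apply/andP; split.
  do 2 apply/push_leP.
  by have /push_leP := lexx (push (frame_hom_comp t s) a).
apply/push_leP; have /push_leP/push_leP := lexx (push t (push s a)).
by [].
Qed.

Definition tensor_functor : functor catJ catS :=
  @Functor catJ catS tensor tensor_map tensor_map_id tensor_map_comp.

(** [f_L : G^T -> L], where [T] is the set of sup-semilattice morphisms [G -> L]. *)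
Definition eval_join (L : sup_semilattice) (x : power H (hom_frame H L)) : L :=
  join [set alpha (x alpha) | alpha in [set: hom_frame H L]].

End Tensor.

Arguments tensor_rel H J : clear implicits.

(* Main.v *)
(** Every map below is determined by its upper bounds. A fixed point [b] of
    [j[J,H]] satisfies [F x <= b i -> x <= b k] whenever [i S k], and
    [n(x_{i=}) <= b] iff [x <= b i]; this makes [phi_J] a frame homomorphism.
    Likewise [f_L a <= l] iff [a alpha <= alpha^*(l)] for all [alpha], where
    [alpha^*] is the right adjoint of [alpha]; since [alpha |-> alpha^*(l)] is a
    fixed point of [j], [f_L] factors through [n(j)] and gives [psi_L].
    Naturality and the triangle identities follow by evaluating on
    elements [n(a)]. *)
Require Import Defs.
From mathcomp Require Import all_boot all_order.
From mathcomp Require Import boolp classical_sets.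

Set Implicit Arguments.
Unset Strict Implicit.
Unset Printing Implicit Defensive.

Import Order.TTheory.
Local Open Scope classical_set_scope.
Local Open Scope order_scope.

(** Taking [b] to be [y] and then [x] gives both inequalities. Equations between joins thus reduce
    to comparing adjunction conditions. *)
Lemma eq_upper_bounds (L : sup_semilattice) (x y : L) :
  (forall b, x <= b <-> y <= b) -> x = y.
Proof. by move=> xy; apply/eqP; rewrite eq_le; apply/andP; split; apply/xy. Qed.

(** Left adjoints preserve joins; this makes sup-semilattice morphisms out of the components of unit
    and counit. *)
Lemma galois_join (K L : sup_semilattice) (f : K -> L) (r : L -> K) :
  (forall a b, f a <= b <-> a <= r b) ->
  forall A, f (join A) = join (f @` A).
Proof.
move=> fr A; apply/esym/join_unique; split=> [_ [a Aa <-]|b bA].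
  by apply/fr; apply: le_trans (join_ub Aa) _; apply/fr.
by apply/fr; apply: join_least => a Aa; apply/fr/bA; exists a.
Qed.

Section RightAdjoint.
Variables (K L : sup_semilattice) (f : sup_hom K L).

Definition radj (l : L) : K := join [set x | f x <= l].

(** Since [f] preserves joins, [f (radj l)] is a join of elements below [l], so [radj l] is the
    largest solution of [f x <= l]. *)
Lemma radjP x l : f x <= l <-> x <= radj l.
Proof.
split=> [xl|/(sup_hom_le f) xl]; first exact: join_ub.
apply: le_trans xl _; rewrite sup_hom_join.
by apply: join_least => _ [y yl <-].
Qed.

End RightAdjoint.

Section Adjunction.
Variable H : F_sup_semilattice.

Lemma tensor_n_val (J : frame) (b : tensor H J) : tensor_n (val b) = b.
Proof. exact: quot_mapK. Qed.

Lemma tensor_map_n (J1 J2 : frame) (t : frame_hom J1 J2) (a : power H J1) :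
  tensor_map H t (tensor_n a) = tensor_n (push t a).
Proof. exact: (congr1 (@^~ a) (tensor_mapP H t)). Qed.

Lemma push_x_eq (J1 J2 : frame) (t : frame_hom J1 J2) (i : J1) (x : H) :
  push t (x_eq i x) = x_eq (t i) x.
Proof.
by apply: eq_upper_bounds => b; rewrite push_leP !x_eq_le.
Qed.

Section Unit.
Variable J : frame.

(** The right adjoint is evaluation of fixed points at [i]. *)
Lemma unit_le (i : J) (x : H) (b : tensor H J) :
  tensor_n (x_eq i x) <= b <-> x <= val b i.
Proof. by rewrite tensor_n_le x_eq_le. Qed.

Definition unit_sup_hom (i : J) : sup_hom H (tensor H J) :=
  SupHom (galois_join (unit_le i)).

Lemma unit_rel (i k : J) : fr_rel i k ->
  @fr_rel (hom_frame H (tensor H J)) (unit_sup_hom i) (unit_sup_hom k).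
Proof.
move=> ik x; apply/unit_le.
(* The fixed point [b] generated by [F x] at [i] satisfies [F x <= b i], hence [x <= b k]. *)
have /tensor_fixP bJ := quot_fix (unit_sup_hom i (fs_op H x)).
by apply: bJ ik _; apply/unit_le.
Qed.

Definition unit_frame_hom : frame_hom J (hom_frame H (tensor H J)) :=
  @FrameHom J (hom_frame H (tensor H J)) unit_sup_hom unit_rel.

End Unit.

Section Counit.
Variable L : sup_semilattice.

Lemma eval_join_le (a : power H (hom_frame H L)) (l : L) :
  eval_join a <= l <-> forall alpha : hom_frame H L, sup_fun alpha (a alpha) <= l.
Proof.
split=> [al alpha|al]; last by apply: join_least => _ [alpha _ <-].
by apply: le_trans al; apply: join_ub; exists alpha.
Qed.

Definition eval_radj (l : L) : power H (hom_frame H L) :=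
  fun alpha => radj alpha l.

Lemma eval_radjP (a : power H (hom_frame H L)) (l : L) :
  eval_join a <= l <-> a <= eval_radj l.
Proof.
rewrite eval_join_le; split=> [al|/lefP al]; last by move=> alpha; apply/radjP.
by apply/lefP => alpha; apply/radjP.
Qed.

(** If [alpha] is related to [beta] and [alpha (F x) <= l], then [beta x <= alpha (F x) <= l]. *)
Lemma eval_radj_fix (l : L) :
  jop (tensor_rel H (hom_frame H L)) (eval_radj l) = eval_radj l.
Proof.
apply/tensor_fixP => x alpha beta ab xl; apply/radjP.
by apply: le_trans (ab x) _; apply/radjP.
Qed.

Definition counit_radj (l : L) : tensor H (hom_frame H L) :=
  exist _ (eval_radj l) (mem_set (eval_radj_fix l)).

Lemma counit_le (a : tensor H (hom_frame H L)) (l : L) :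
  eval_join (val a) <= l <-> a <= counit_radj l.
Proof. exact: eval_radjP. Qed.

Definition counit_sup_hom : sup_hom (tensor H (hom_frame H L)) L :=
  SupHom (galois_join counit_le).

(** As [eval_radj l] is a fixed point, it lies above [a] exactly when it lies above the closure of
    [a]. *)
Lemma counit_n (a : power H (hom_frame H L)) :
  counit_sup_hom (tensor_n a) = eval_join a.
Proof.
by apply: eq_upper_bounds => l; rewrite counit_le tensor_n_le eval_radjP.
Qed.

Lemma eval_join_push (T : Type) (t : T -> hom_frame H L) (a : power H T) (l : L) :
  eval_join (push t a) <= l <-> forall i, sup_fun (t i) (a i) <= l.
Proof.
rewrite eval_radjP push_leP; split=> [/lefP al i|al]; first exact/radjP/al.
by apply/lefP => i; apply/radjP/al.
Qed.

Lemma eval_join_x_eq (alpha : hom_frame H L) (x : H) :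
  eval_join (x_eq alpha x) = sup_fun alpha x.
Proof.
by apply: eq_upper_bounds => l; rewrite eval_radjP x_eq_le radjP.
Qed.

End Counit.

(** Either side is below [l] iff [g (alpha (a alpha)) <= l] for all [alpha]; on the right, [g] is
    moved across by its adjoint. *)
Lemma eval_join_hom_frame_map (L1 L2 : sup_semilattice) (g : sup_hom L1 L2)
    (a : power H (hom_frame H L1)) :
  eval_join (push (hom_frame_map H g) a) = g (eval_join a).
Proof.
apply: eq_upper_bounds => l; rewrite eval_join_push radjP eval_join_le.
by split=> al alpha; apply/(radjP g)/al.
Qed.

Lemma unit_natural :
  natural (P := functor_id catJ)
    (Q := functor_comp (hom_functor H) (tensor_functor H)) unit_frame_hom.
Proof.
move=> J1 J2 t; apply: frame_hom_eq => i; apply: sup_hom_eq => x /=.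
by rewrite tensor_map_n push_x_eq.
Qed.

Lemma counit_natural :
  natural (P := functor_comp (tensor_functor H) (hom_functor H))
    (Q := functor_id catS) counit_sup_hom.
Proof.
move=> L1 L2 g; apply: sup_hom_eq => a.
change (g (counit_sup_hom L1 a) =
  counit_sup_hom L2 (tensor_map H (hom_frame_map H g) a)).
by rewrite -(tensor_n_val a) tensor_map_n !counit_n eval_join_hom_frame_map.
Qed.

(** First triangle identity: the left side is the join over [i] of the closures of [x_eq i (a i)],
    which is below [b] iff [a i <= b i] for all [i]. *)
Lemma counit_unit_tensor (J : frame) (a : tensor H J) :
  counit_sup_hom (tensor H J) (tensor_map H (unit_frame_hom J) a) = a.
Proof.
rewrite -{1}(tensor_n_val a) tensor_map_n counit_n.
apply: eq_upper_bounds => b; rewrite eval_join_push.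
split=> [ab|/lefP ab i]; last exact/unit_le/ab.
by apply/lefP => i; apply/unit_le/ab.
Qed.

(** Second triangle identity, evaluated at [alpha] and [x]. *)
Lemma counit_unit_hom_frame (L : sup_semilattice) (alpha : hom_frame H L) (x : H) :
  counit_sup_hom L (unit_sup_hom alpha x) = sup_fun alpha x.
Proof. by rewrite counit_n eval_join_x_eq. Qed.

End Adjunction.

Theorem theorem4p2 (H : F_sup_semilattice) :
  exists (phi : forall J : frame, frame_hom J (hom_frame H (tensor H J)))
         (psi : forall L : sup_semilattice,
                  sup_hom (tensor H (hom_frame H L)) L),
  [/\ (forall J : frame,
         unique (fun p : frame_hom J (hom_frame H (tensor H J)) =>
                   forall (x : H) (i : J),
                     (p i : sup_hom H (tensor H J)) x
                     = tensor_n (x_eq (H := H) i x))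
                (phi J))
      /\ natural (P := functor_id catJ)
                 (Q := functor_comp (hom_functor H) (tensor_functor H)) phi,
      (forall L : sup_semilattice,
         unique (fun q : sup_hom (tensor H (hom_frame H L)) L =>
                   q \o @tensor_n H (hom_frame H L) = @eval_join H L)
                (psi L))
      /\ natural (P := functor_comp (tensor_functor H) (hom_functor H))
                 (Q := functor_id catS) psi
    & adjoint_situation (L := tensor_functor H) (R := hom_functor H) phi psi].
Proof.
exists (unit_frame_hom H), (counit_sup_hom H); split.
- split=> [J|]; last exact: unit_natural.
  split=> // p pE; apply: frame_hom_eq => i; apply: sup_hom_eq => x.
  by rewrite pE.
- split=> [L|]; last exact: counit_natural.
  split=> [|q qE]; first by apply/funext => a; apply: counit_n.
  (* Every [a] is the closure of itself, so [q] is determined by its composite with [tensor_n]. *)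
  apply: sup_hom_eq => a; rewrite -(tensor_n_val a) counit_n.
  exact: esym (congr1 (@^~ (val a)) qE).
- split; [exact: unit_natural|exact: counit_natural| |].
    by move=> J; apply: sup_hom_eq => a; apply: counit_unit_tensor.
  move=> L; apply: frame_hom_eq => alpha; apply: sup_hom_eq => x.
  exact: counit_unit_hom_frame.
Qed.
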